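(* Let $k$ be a commutative ring. For every cocomplete graded-augmented counital dg $k$-coalgebra $C$, the functor $$\mathsf{Alg}_{[0,2]}\to\mathsf{Sets},\qquad A\mapsto\mathsf{Tw}(C,A)$$ is corepresentable. Denote by $\Omega C$ (the cobar construction of $C$) a corepresentative. Moreover, the assignment $C\mapsto\Omega C$ extends to a covariant functor $$\Omega:\mathsf{CgaCdg}\to\mathsf{Alg}_{[0,2]}$$ such that the isomorphism $\mathsf{Tw}(C,?)\cong\mathsf{Alg}_{[0,2]}(\Omega C,?)$ is natural in $C$.
   Context: $k$ is a commutative associative unital ring; graded means $\mathbf Z$-graded; $\otimes=\otimes_k$; Koszul sign rule $(f\otimes g)(u\otimes v)=(-1)^{|g||u|}f(u)\otimes g(v)$. $\mathsf{Alg}_{[0,2]}$ is the category of curved dg (cdg) algebras over $k$ (not necessarily unital): graded $k$-modules $A$ with an associative degree $0$ multiplication, an element $c\in A^2$ (the curvature) and a degree $1$ map $d:A\to A$ with $d(c)=0$, $d(d(a))=ca-ac$ and $d(ab)=d(a)b+(-1)^{|a|}a\,d(b)$. Morphisms are degree $0$ $k$-linear maps preserving the curvature and the multiplication and commuting with $d$. Write $m_0:k\to A$, $1\mapsto c$, $m_1=d$, $m_2$ the multiplication. $\mathsf{CgaCdg}$ is the category of cocomplete graded-augmented counital dg $k$-coalgebras: objects $(C,d,\Delta,\varepsilon,\eta)$ with $(C,d,\Delta,\eta)$ a counital dg coalgebra (coassociative graded coalgebra with counit $\eta:C\to k$ and a square-zero degree $1$ coderivation $d$) and $(C,\Delta,\varepsilon,\eta)$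 an augmented graded coalgebra with augmentation $\varepsilon:k\to C$ (not required to satisfy $d\varepsilon=0$) which is cocomplete: the reduced coalgebra $\overline C=\mathrm{cok}\,\varepsilon$ is the colimit of the kernels of the iterated comultiplications $\overline\Delta^{(n)}:\overline C\to\overline C^{\otimes n}$, $n\ge2$. Morphisms are coalgebra morphisms compatible with augmentations, counits and codifferentials. For $C\in\mathsf{CgaCdg}$ and a cdg algebra $A$, the set $\mathsf{Tw}(C,A)$ of twisting cochains consists of the degree $1$ $k$-linear maps $\tau:C\to A$ with $\tau\varepsilon=0$ and satisfying the Maurer-Cartan equation $$m_0\eta+(m_1\tau+\tau d_C)+m_2(\tau\otimes\tau)\Delta=0.$$ It is covariant in $A$ by postcomposition and contravariant in $C$ by precomposition. *)

(* Defs.v *)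
From HB Require Import structures.
From mathcomp Require Import all_boot all_order all_algebra.
From mathcomp Require Import boolp.
Set Implicit Arguments.
Unset Strict Implicit.
Unset Printing Implicit Defensive.
Import GRing.Theory.
Local Open Scope ring_scope.
Local Open Scope quotient_scope.

Record premodule (k : comPzRingType) := Premodule {
  pm_car : Type;
  pm_eq : pm_car -> pm_car -> Prop;
  pm_zero : pm_car;
  pm_add : pm_car -> pm_car -> pm_car;
  pm_opp : pm_car -> pm_car;
  pm_scale : k -> pm_car -> pm_car;
  pm_refl : forall x, pm_eq x x;
  pm_sym : forall x y, pm_eq x y -> pm_eq y x;
  pm_trans : forall x y z, pm_eq x y -> pm_eq y z -> pm_eq x z;
  pm_add_eq : forall x x' y y',
    pm_eq x x' -> pm_eq y y' -> pm_eq (pm_add x y) (pm_add x' y');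
  pm_opp_eq : forall x x', pm_eq x x' -> pm_eq (pm_opp x) (pm_opp x');
  pm_scale_eq : forall a x x',
    pm_eq x x' -> pm_eq (pm_scale a x) (pm_scale a x');
  pm_addA : forall x y z,
    pm_eq (pm_add x (pm_add y z)) (pm_add (pm_add x y) z);
  pm_addC : forall x y, pm_eq (pm_add x y) (pm_add y x);
  pm_add0 : forall x, pm_eq (pm_add pm_zero x) x;
  pm_addN : forall x, pm_eq (pm_add (pm_opp x) x) pm_zero;
  pm_scaleA : forall a b x,
    pm_eq (pm_scale a (pm_scale b x)) (pm_scale (a * b) x);
  pm_scale1 : forall x, pm_eq (pm_scale 1 x) x;
  pm_scaleDr : forall a x y,
    pm_eq (pm_scale a (pm_add x y)) (pm_add (pm_scale a x) (pm_scale a y));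
  pm_scaleDl : forall a b x,
    pm_eq (pm_scale (a + b) x) (pm_add (pm_scale a x) (pm_scale b x))
}.

Section ModuleQuotient.
Variables (k : comPzRingType) (P : premodule k).

Definition pm_rel : rel {classic pm_car P} := fun x y => `[< pm_eq x y >].

Lemma pm_relP : equiv_class_of pm_rel.
Proof.
split=> [x|x y|y x z]; first by apply/asboolP/pm_refl.
- by apply/asboolP/asboolP; apply: pm_sym.
- by move=> /asboolP xy /asboolP yz; apply/asboolP/(pm_trans xy).
Qed.

Definition pm_equiv := EquivRelPack pm_relP.

Definition mquot := {eq_quot pm_equiv}.
HB.instance Definition _ := Choice.on mquot.

Definition mclass (x : pm_car P) : mquot := \pi_mquot (x : {classic pm_car P}).
Definition mrep (q : mquot) : pm_car P := repr q.

Lemma mclassP x y : mclass x = mclass y <-> pm_eq x y.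
Proof. by rewrite /mclass; split=> [/eqmodP/asboolP|h] //; apply/eqmodP/asboolP. Qed.

Lemma mrepK q : mclass (mrep q) = q.
Proof. exact: reprK. Qed.

Lemma mrep_eq x : pm_eq (mrep (mclass x)) x.
Proof. by apply/mclassP; rewrite mrepK. Qed.

Lemma mquotW (Q : mquot -> Prop) : (forall x, Q (mclass x)) -> forall q, Q q.
Proof. by move=> h q; rewrite -(mrepK q). Qed.

Definition mq_add (p q : mquot) := mclass (pm_add (mrep p) (mrep q)).
Definition mq_opp (p : mquot) := mclass (pm_opp (mrep p)).
Definition mq_scale (a : k) (p : mquot) := mclass (pm_scale a (mrep p)).

Lemma mq_addE x y : mq_add (mclass x) (mclass y) = mclass (pm_add x y).
Proof. by apply/mclassP/pm_add_eq; apply: mrep_eq. Qed.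
Lemma mq_oppE x : mq_opp (mclass x) = mclass (pm_opp x).
Proof. by apply/mclassP/pm_opp_eq/mrep_eq. Qed.
Lemma mq_scaleE a x : mq_scale a (mclass x) = mclass (pm_scale a x).
Proof. by apply/mclassP/pm_scale_eq/mrep_eq. Qed.

Lemma mq_addA : associative mq_add.
Proof.
elim/mquotW=> x; elim/mquotW=> y; elim/mquotW=> z.
by rewrite !mq_addE; apply/mclassP/pm_addA.
Qed.
Lemma mq_addC : commutative mq_add.
Proof.
by elim/mquotW=> x; elim/mquotW=> y; rewrite !mq_addE; apply/mclassP/pm_addC.
Qed.
Lemma mq_add0 : left_id (mclass (pm_zero P)) mq_add.
Proof. by elim/mquotW=> x; rewrite mq_addE; apply/mclassP/pm_add0. Qed.
Lemma mq_addN : left_inverse (mclass (pm_zero P)) mq_opp mq_add.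
Proof.
by elim/mquotW=> x; rewrite mq_oppE mq_addE; apply/mclassP/pm_addN.
Qed.

HB.instance Definition _ :=
  GRing.isZmodule.Build mquot mq_addA mq_addC mq_add0 mq_addN.

Lemma mq_scaleA a b q : mq_scale a (mq_scale b q) = mq_scale (a * b) q.
Proof.
by elim/mquotW: q => x; rewrite !mq_scaleE; apply/mclassP/pm_scaleA.
Qed.
Lemma mq_scale1 : left_id 1 mq_scale.
Proof. by elim/mquotW=> x; rewrite mq_scaleE; apply/mclassP/pm_scale1. Qed.
Lemma mq_scaleDr : right_distributive mq_scale +%R.
Proof.
move=> a; elim/mquotW=> x; elim/mquotW=> y.
by rewrite [mclass x + _]mq_addE !mq_scaleE [RHS]mq_addE; apply/mclassP/pm_scaleDr.
Qed.
Lemma mq_scaleDl q : {morph mq_scale^~ q : a b / a + b}.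
Proof.
move=> a b; elim/mquotW: q => x.
by rewrite !mq_scaleE [RHS]mq_addE; apply/mclassP/pm_scaleDl.
Qed.

HB.instance Definition _ := GRing.Zmodule_isLmodule.Build k mquot
  mq_scaleA mq_scale1 mq_scaleDr mq_scaleDl.

Lemma mclassD x y : mclass (pm_add x y) = mclass x + mclass y.
Proof. by rewrite -mq_addE. Qed.
Lemma mclassZ a x : mclass (pm_scale a x) = a *: mclass x.
Proof. by rewrite -mq_scaleE. Qed.
Lemma mclass0 : mclass (pm_zero P) = 0.
Proof. by []. Qed.
End ModuleQuotient.

Definition lin_pack (k : comPzRingType) (U V : lmodType k) (f : U -> V)
    (hf : linear f) : {linear U -> V} :=
  HB.pack f (GRing.isLinear.Build k U V *:%R f hf).

Lemma lin_ext (k : comPzRingType) (U V : lmodType k) (f g : {linear U -> V}) :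
  f =1 g -> f = g.
Proof.
case: f g => [f hf] [g hg] /= /funext fg; move: hf hg; rewrite {}fg => hf hg.
congr GRing.Linear.Pack.
case: hf hg => [[a] [b]] [[a'] [b']].
by rewrite (Prop_irrelevance a a') (Prop_irrelevance b b').
Qed.

Definition bilin (k : comPzRingType) (U V W : lmodType k) (b : U -> V -> W) :=
  (forall v, linear (b^~ v)) /\ (forall u, linear (b u)).

Definition gmod (k : comPzRingType) := int -> lmodType k.
Identity Coercion gmod_component : gmod >-> Funclass.

Definition gcast (k : comPzRingType) (C : gmod k) (i j : int) (e : i = j) :
    {linear C i -> C j} :=
  match e with erefl => idfun : {linear C i -> C i} end.

(* The k-linear maps of degree p. The target degree is a separate index, tied
   to n + p by a proof, so that no transport is needed in composites; a map is
   determined by its components with m := n + p. *)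
Definition gmap (k : comPzRingType) (p : int) (C D : gmod k) :=
  forall n m : int, n + p = m -> {linear C n -> D m}.

Section GradedMaps.
Variable k : comPzRingType.
Implicit Types C D E : gmod k.

Lemma gcast_id C i (e : i = i) x : gcast C e x = x.
Proof. by rewrite (eq_irrelevance e erefl). Qed.

Lemma gcastK C i j l (e : i = j) (e' : j = l) (e'' : i = l) x :
  gcast C e' (gcast C e x) = gcast C e'' x.
Proof. by subst j l; rewrite !gcast_id. Qed.

Lemma gmap_ext p C D (f g : gmap p C D) :
  (forall n m (e : n + p = m), f n m e =1 g n m e) -> f = g.
Proof.
move=> fg; apply: functional_extensionality_dep => n.
apply: functional_extensionality_dep => m.
by apply: functional_extensionality_dep => e; apply/lin_ext/fg.
Qed.

Definition gcomp p q C D E (g : gmap q D E) (f : gmap p C D) :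
    gmap (p + q) C E :=
  fun n m e => g (n + p) m (etrans (esym (addrA n p q)) e) \o f n (n + p) erefl.

Definition gid C : gmap 0 C C :=
  fun n m e => gcast C (etrans (esym (addr0 n)) e).

Definition gadd p C D (f g : gmap p C D) : gmap p C D :=
  fun n m e => f n m e \+ g n m e.

Definition gzero p C D : gmap p C D := fun n m e => \0.

Definition gapp0 C D (f : gmap 0 C D) (n : int) : {linear C n -> D n} :=
  f n n (addr0 n).

Lemma gmapE p C D (f : gmap p C D) n m (e e' : n + p = m) : f n m e = f n m e'.
Proof. by rewrite (eq_irrelevance e e'). Qed.

Lemma gcompE p q C D E (g : gmap q D E) (f : gmap p C D) n m l
    (e1 : n + p = m) (e2 : m + q = l) (e : n + (p + q) = l) x :
  gcomp g f e x = g m l e2 (f n m e1 x).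
Proof.
by subst m; rewrite /gcomp /=; congr (g _ _ _ _); apply: eq_irrelevance.
Qed.

Lemma gidE C n (e : n + 0 = n) x : gid C e x = x.
Proof. by rewrite /gid gcast_id. Qed.

Lemma gcomp_id p C D (f : gmap p C D) n m (e : n + (0 + p) = m) e' x :
  gcomp f (gid C) e x = f n m e' x.
Proof. by rewrite (gcompE _ _ (addr0 n) e') gidE. Qed.

Lemma gid_comp p C D (f : gmap p C D) n m (e : n + (p + 0) = m) e' x :
  gcomp (gid D) f e x = f n m e' x.
Proof. by rewrite (gcompE _ _ e' (addr0 m)) gidE. Qed.

Lemma gcomp0E q C D E (g : gmap q D E) (f : gmap 0 C D) n m
    (e : n + (0 + q) = m) (e' : n + q = m) x :
  gcomp g f e x = g n m e' (f n n (addr0 n) x).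
Proof. exact: gcompE. Qed.

Lemma gcompA p q r B C D E (h : gmap r D E) (g : gmap q C D) (f : gmap p B C)
    n m (e : n + (p + q + r) = m) (e' : n + (p + (q + r)) = m) x :
  gcomp h (gcomp g f) e x = gcomp (gcomp h g) f e' x.
Proof.
have eq : n + (p + q) = n + p + q by rewrite addrA.
have er : n + p + q + r = m by rewrite -e !addrA.
have eqr : n + p + (q + r) = m by rewrite -e !addrA.
rewrite (gcompE h _ eq er) (gcompE g f erefl (esym (esym erefl))).
by rewrite (gcompE _ f erefl eqr) (gcompE h g erefl er).
Qed.
End GradedMaps.

Arguments gzero {k p C D} [n m].
Arguments gcompA {k} p q r {B C D E} h g f {n m}.

Notation "g \oG f" := (gcomp g f) (at level 50, left associativity).
Notation "f \+G g" := (gadd f g) (at level 52, left associativity).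
Notation "f @0 x" := (gapp0 f _ x) (at level 10, left associativity, x at level 9).

Section Tensor.
Variables (k : comPzRingType) (C D : gmod k) (n : int).

Record pure_tensor := Pure {
  pt_l : int; pt_r : int; pt_deg : pt_l + pt_r = n;
  pt_x : C pt_l; pt_y : D pt_r }.

(* The degree n part of C (x) D is the sum of the C i (x) D j over i + j = n,
   presented by generators (pure tensors) and relations (bilinearity). A
   general element is the class of a formal sum of pure tensors; coefficients
   are absorbed in the left factors. *)
Inductive tensor_eq : seq pure_tensor -> seq pure_tensor -> Prop :=
| TeqRefl s : tensor_eq s s
| TeqSym s t : tensor_eq s t -> tensor_eq t s
| TeqTrans s t u : tensor_eq s t -> tensor_eq t u -> tensor_eq s u
| TeqCat s s' t t' :
    tensor_eq s s' -> tensor_eq t t' -> tensor_eq (s ++ t) (s' ++ t')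
| TeqC s t : tensor_eq (s ++ t) (t ++ s)
| Teq0 i j (e : i + j = n) (y : D j) : tensor_eq [:: Pure e 0 y] [::]
| TeqDl i j (e : i + j = n) (x x' : C i) (y : D j) :
    tensor_eq [:: Pure e (x + x') y] [:: Pure e x y; Pure e x' y]
| TeqDr i j (e : i + j = n) (x : C i) (y y' : D j) :
    tensor_eq [:: Pure e x (y + y')] [:: Pure e x y; Pure e x y']
| TeqZ i j (e : i + j = n) (a : k) (x : C i) (y : D j) :
    tensor_eq [:: Pure e (a *: x) y] [:: Pure e x (a *: y)].

Definition pure_scale (a : k) (t : pure_tensor) :=
  Pure (pt_deg t) (a *: pt_x t) (pt_y t).

Lemma scale_tensor_eq a s t : tensor_eq s t ->
  tensor_eq (map (pure_scale a) s) (map (pure_scale a) t).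
Proof.
elim=> {s t} /= [s|s t _ h|s t u _ h _ h'|s s' t t' _ h _ h'|s t|i j e y
  |i j e x x' y|i j e x y y'|i j e b x y].
- exact: TeqRefl.
- exact: TeqSym.
- exact: TeqTrans h'.
- by rewrite !map_cat; apply: TeqCat.
- by rewrite !map_cat; apply: TeqC.
- by rewrite /pure_scale /= scaler0; apply: Teq0.
- by rewrite /pure_scale /= scalerDr; apply: TeqDl.
- exact: TeqDr.
- by rewrite /pure_scale /= scalerA mulrC -scalerA; apply: TeqZ.
Qed.

Lemma addN_tensor_eq s : tensor_eq (map (pure_scale (-1)) s ++ s) [::].
Proof.
elim: s => [|[i j e x y] s IHs]; first exact: TeqRefl.
have h : tensor_eq ([:: Pure e (-1 *: x) y] ++ [:: Pure e x y]) [::].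
  apply: TeqTrans (TeqSym (TeqDl e (-1 *: x) x y)) _.
  by rewrite scaleN1r addNr; apply: Teq0.
apply: (@TeqTrans _
  (([:: Pure e (-1 *: x) y] ++ [:: Pure e x y])
   ++ (map (pure_scale (-1)) s ++ s))); last exact: (TeqCat h IHs).
rewrite -catA /= -[X in tensor_eq X]cat1s -[X in tensor_eq _ X]cat1s.
apply: TeqCat; first exact: TeqRefl.
rewrite -[in X in tensor_eq X _](cat1s (Pure e x y) s) catA.
rewrite -[in X in tensor_eq _ X]cat1s catA.
by apply: TeqCat; [apply: TeqC | apply: TeqRefl].
Qed.

Lemma mapD_tensor_eq a b s :
  tensor_eq (map (pure_scale (a + b)) s)
    (map (pure_scale a) s ++ map (pure_scale b) s).
Proof.
elim: s => [|[i j e x y] s IHs] /=; first exact: TeqRefl.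
apply: (@TeqTrans _ ([:: Pure e (a *: x) y; Pure e (b *: x) y]
  ++ (map (pure_scale a) s ++ map (pure_scale b) s))).
  rewrite -cat1s; apply: TeqCat => //.
  by rewrite /pure_scale /= scalerDl; apply: TeqDl.
rewrite /= -[X in tensor_eq X]cat1s -[X in tensor_eq _ X]cat1s.
apply: TeqCat; first exact: TeqRefl.
rewrite -[in X in tensor_eq X _]cat1s catA.
rewrite -[in X in tensor_eq _ X](cat1s _ (map (pure_scale b) s)) catA.
by apply: TeqCat; [apply: TeqC | apply: TeqRefl].
Qed.

Definition tensor_premodule : premodule k.
Proof.
refine (@Premodule k (seq pure_tensor) tensor_eq [::] cat
  (map (pure_scale (-1))) (fun a => map (pure_scale a))
  TeqRefl TeqSym TeqTrans TeqCat _ scale_tensor_eq _ TeqC _ addN_tensor_eq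
  _ _ _ mapD_tensor_eq).
- by move=> x x'; apply: scale_tensor_eq.
- by move=> x y z; rewrite catA; apply: TeqRefl.
- by move=> x; apply: TeqRefl.
- move=> a b x; rewrite -map_comp (_ : map _ x = map (pure_scale (a * b)) x).
    exact: TeqRefl.
  by apply: eq_map => t; rewrite /= /pure_scale /= scalerA.
- move=> x; rewrite (_ : map _ x = x); first exact: TeqRefl.
  rewrite -[RHS]map_id; apply: eq_map => -[i j e u v].
  by rewrite /pure_scale /= scale1r.
- by move=> a x y; rewrite map_cat; apply: TeqRefl.
Defined.
End Tensor.
Arguments Pure {k C D n pt_l pt_r}.

Definition gtensor (k : comPzRingType) (C D : gmod k) : gmod k :=
  fun n => mquot (tensor_premodule C D n).

Notation "C \otG D" := (gtensor C D) (at level 40, left associativity).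

Section TensorMaps.
Variable k : comPzRingType.
Implicit Types C D E : gmod k.

Definition tpure C D i j n (e : i + j = n) (x : C i) (y : D j) :
    (C \otG D) n :=
  @mclass k (tensor_premodule C D n) [:: Pure e x y].

Lemma tpure_bilin C D i j n (e : i + j = n) : bilin (@tpure C D i j n e).
Proof.
have Z a x y : tpure e (a *: x) y = a *: tpure e x y :> (C \otG D) n.
  by rewrite -[RHS]mclassZ.
split=> [y a x x'|x a y y'].
  by rewrite -Z /tpure -[RHS]mclassD; apply/mclassP/TeqDl.
transitivity (tpure e x (a *: y) + tpure e x y' : (C \otG D) n).
  by rewrite /tpure -[RHS]mclassD; apply/mclassP/TeqDr.
by rewrite -Z; congr (_ + _); apply/esym/mclassP/TeqZ.
Qed.

Lemma tensor_ext C D (n : int) (V : lmodType k)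
    (f g : {linear (C \otG D) n -> V}) :
  (forall i j (e : i + j = n) x y, f (tpure e x y) = g (tpure e x y)) ->
  f =1 g.
Proof.
move=> fg; elim/mquotW; elim=> [|[i j e x y] s IHs].
  by rewrite [mclass _]mclass0 !raddf0.
have -> : mclass (P := tensor_premodule C D n) (Pure e x y :: s)
    = tpure e x y + mclass (P := tensor_premodule C D n) s by rewrite -[RHS]mclassD.
by rewrite !raddfD; congr (_ + _); [exact: fg | exact: IHs].
Qed.

Section Lift.
Variables (p : int) (C D E : gmod k).
Variable b : forall i j m : int, i + j + p = m -> C i -> D j -> E m.
Hypothesis hb : forall i j m (e : i + j + p = m), bilin (b e).

Definition tlift_sum n m (e : n + p = m) (s : seq (pure_tensor C D n)) : E m :=
  \sum_(t <- s)
    b (etrans (congr1 (fun l => l + p) (pt_deg t)) e) (pt_x t) (pt_y t).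

Lemma tlift_sum_eq n m (e : n + p = m) s s' :
  tensor_eq s s' -> tlift_sum e s = tlift_sum e s'.
Proof.
rewrite /tlift_sum; elim=> {s s'} //= [s t u _ -> _ -> //|s s' t t' _ h _ h'|s t
  |i j ei y|i j ei x x' y|i j ei x y y'|i j ei a x y].
- by rewrite !big_cat h h'.
- by rewrite !big_cat /=; apply: addrC.
- rewrite big_seq1 big_nil /=.
  have [/(_ y) L _] := hb (etrans (congr1 (fun l => l + p) ei) e).
  by have := L (-1) 0 0; rewrite scaler0 addr0 scaleN1r addNr.
- rewrite !big_cons !big_nil /= !addr0.
  have [/(_ y) L _] := hb (etrans (congr1 (fun l => l + p) ei) e).
  by have := L 1 x x'; rewrite !scale1r.
- rewrite !big_cons !big_nil /= !addr0.
  have [_ /(_ x) L] := hb (etrans (congr1 (fun l => l + p) ei) e).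
  by have := L 1 y y'; rewrite !scale1r.
- rewrite !big_seq1 /=.
  have [/(_ y) L /(_ x) L'] := hb (etrans (congr1 (fun l => l + p) ei) e).
  by rewrite (scalable_linear L) (scalable_linear L').
Qed.

Definition tlift_fun n m (e : n + p = m) (q : (C \otG D) n) : E m :=
  tlift_sum e (mrep q).

Lemma tlift_funE n m (e : n + p = m) s :
  tlift_fun e (mclass (P := tensor_premodule C D n) s) = tlift_sum e s.
Proof. exact: tlift_sum_eq (@mrep_eq k (tensor_premodule C D n) s). Qed.

Lemma tlift_linear n m (e : n + p = m) : linear (tlift_fun e).
Proof.
move=> a; elim/mquotW=> s; elim/mquotW=> t.
rewrite -mclassZ -mclassD !tlift_funE /tlift_sum big_cat big_map scaler_sumr.
congr (_ + _); apply: eq_bigr => u _ /=.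
have [/(_ (pt_y u)) L _] := hb (etrans (congr1 (fun l => l + p) (pt_deg u)) e).
exact: scalable_linear L _ _.
Qed.

Definition tlift : gmap p (C \otG D) E :=
  fun n m e => lin_pack (tlift_linear e).

Lemma tliftE i j n m (e : i + j = n) (e' : n + p = m) (e'' : i + j + p = m)
    x y :
  tlift e' (tpure e x y) = b e'' x y.
Proof.
rewrite /= tlift_funE /tlift_sum big_seq1 /=.
by rewrite (eq_irrelevance (etrans _ _) e'').
Qed.
End Lift.
End TensorMaps.

Section KoszulTensor.
Variable k : comPzRingType.
Implicit Types C D E : gmod k.

Definition ksign (i : int) : k := (-1) ^+ `|i|%N.

Section TensorOfMaps.
Variables (p q : int) (C C' D D' : gmod k).
Variables (f : gmap p C C') (g : gmap q D D').

(* (f (x) g)(x (x) y) = (-1)^(|g||x|) f(x) (x) g(y) *)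
Definition gten_pure i j m (e : i + j + (p + q) = m) (x : C i) (y : D j) :
    (C' \otG D') m :=
  ksign (q * i) *: tpure (etrans (addrACA i p j q) e) (f erefl x) (g erefl y).

Lemma gten_pure_bilin i j m (e : i + j + (p + q) = m) : bilin (gten_pure e).
Proof.
have [Ll Lr] := tpure_bilin C' D' (etrans (addrACA i p j q) e).
split=> [y a x x'|x a y y']; rewrite /gten_pure linearP.
  by rewrite (Ll _ a) scalerDr !scalerA mulrC.
by rewrite (Lr _ a) scalerDr !scalerA mulrC.
Qed.

Definition gten : gmap (p + q) (C \otG D) (C' \otG D') := tlift gten_pure_bilin.

Lemma gtenE i j n m i' j' (e : i + j = n) (e' : n + (p + q) = m)
    (ei : i + p = i') (ej : j + q = j') (e'' : i' + j' = m) x y :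
  gten e' (tpure e x y) = ksign (q * i) *: tpure e'' (f ei x) (g ej y).
Proof.
have e2 : i + j + (p + q) = m by rewrite e.
rewrite (tliftE _ _ _ e2) /gten_pure; subst i' j'.
by rewrite (eq_irrelevance (etrans _ _) e'').
Qed.
End TensorOfMaps.

(* k, concentrated in degree 0. *)
Definition gunit : gmod k := fun n => if n is Posz 0 then k^o else 'rV[k]_0.

Section Unitors.
Variable C : gmod k.

Definition gunit_actl i j m : i + j + 0 = m -> gunit i -> C j -> C m :=
  match i return i + j + 0 = m -> gunit i -> C j -> C m with
  | Posz 0 => fun e a x =>
      gcast C (etrans (esym (etrans (addr0 _) (add0r j))) e) ((a : k) *: x)
  | _ => fun _ _ _ => 0
  end.

Definition gunit_actr i j m : i + j + 0 = m -> C i -> gunit j -> C m :=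
  match j return i + j + 0 = m -> C i -> gunit j -> C m with
  | Posz 0 => fun e x a =>
      gcast C (etrans (esym (etrans (addr0 _) (addr0 i))) e) ((a : k) *: x)
  | _ => fun _ _ _ => 0
  end.

Lemma gunit_actl_bilin i j m (e : i + j + 0 = m) : bilin (gunit_actl e).
Proof.
case: i e => [[|i]|i] e; split=> [u a v w|u a v w] /=; rewrite ?scaler0 ?addr0 //.
  by rewrite -linearP; congr (gcast _ _ _); rewrite scalerDl scalerA.
by rewrite -linearP; congr (gcast _ _ _); rewrite scalerDr !scalerA mulrC.
Qed.

Lemma gunit_actr_bilin i j m (e : i + j + 0 = m) : bilin (gunit_actr e).
Proof.
case: j e => [[|j]|j] e; split=> [u a v w|u a v w] /=; rewrite ?scaler0 ?addr0 //.
  by rewrite -linearP; congr (gcast _ _ _); rewrite scalerDr !scalerA mulrC.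
by rewrite -linearP; congr (gcast _ _ _); rewrite scalerDl scalerA.
Qed.

Definition lunitor : gmap 0 (gunit \otG C) C := tlift gunit_actl_bilin.
Definition runitor : gmap 0 (C \otG gunit) C := tlift gunit_actr_bilin.
End Unitors.

Section Associator.
Variables C D E : gmod k.

Definition assoc_pure l (z : E l) i j m (e : i + j + l = m) (x : C i) (y : D j)
    : (C \otG (D \otG E)) m :=
  tpure (etrans (addrA i j l) e) x (tpure (erefl (j + l)) y z).

Lemma assoc_pure_bilin l (z : E l) i j m (e : i + j + l = m) :
  bilin (assoc_pure z e).
Proof.
have [Ll Lr] := tpure_bilin C (D \otG E) (etrans (addrA i j l) e).
have [L _] := tpure_bilin D E (erefl (j + l)).
split=> [y a x x'|x a y y']; rewrite /assoc_pure; first exact: Ll.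
by rewrite (L z a); apply: Lr.
Qed.

Definition assoc_fun i l m (e : i + l + 0 = m) (w : (C \otG D) i) (z : E l) :
    (C \otG (D \otG E)) m :=
  tlift (assoc_pure_bilin z) (etrans (esym (addr0 (i + l))) e) w.

Lemma assoc_fun_bilin i l m (e : i + l + 0 = m) : bilin (assoc_fun e).
Proof.
split=> [z a w w'|w a z z']; first by rewrite /assoc_fun linearP.
have e1 := etrans (esym (addr0 (i + l))) e.
pose g : {linear (C \otG D) i -> (C \otG (D \otG E)) m} :=
  (a \*: tlift (assoc_pure_bilin z) e1) \+ tlift (assoc_pure_bilin z') e1.
rewrite /assoc_fun (eq_irrelevance (etrans _ e) e1).
suff -> : tlift (assoc_pure_bilin (a *: z + z')) e1 =1 g by [].
apply: tensor_ext => u v eu x y; subst i.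
rewrite -[RHS]/(a *: tlift (assoc_pure_bilin z) e1 (tpure erefl x y)
  + tlift (assoc_pure_bilin z') e1 (tpure erefl x y)).
rewrite !(tliftE _ _ _ e1) /assoc_pure.
have [_ Lr] := tpure_bilin C (D \otG E) (etrans (addrA u v l) e1).
have [_ L] := tpure_bilin D E (erefl (v + l)).
by rewrite (L y a); apply: Lr.
Qed.

Definition associator : gmap 0 ((C \otG D) \otG E) (C \otG (D \otG E)) :=
  tlift assoc_fun_bilin.

Lemma associatorE i j l ij jl n (e1 : i + j = ij) (e2 : ij + l = n)
    (e3 : j + l = jl) (e4 : i + jl = n) m (e : n + 0 = m) (e4' : i + jl = m)
    x y z :
  associator e (tpure e2 (tpure e1 x y) z) = tpure e4' x (tpure e3 y z).
Proof.
have e' : ij + l + 0 = m by rewrite e2.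
rewrite (tliftE _ _ _ e') /assoc_fun.
have e5 : i + j + l = m by rewrite e1 -e' addr0.
rewrite (tliftE _ _ _ e5) /assoc_pure; subst jl.
by rewrite (eq_irrelevance (etrans _ _) e4').
Qed.
End Associator.

Lemma gtensor_map_ext p C D E (f g : gmap p (C \otG D) E) :
  (forall i j n m (e : i + j = n) (e' : n + p = m) x y,
     f n m e' (tpure e x y) = g n m e' (tpure e x y)) -> f = g.
Proof.
by move=> fg; apply: gmap_ext => n m e; apply: tensor_ext => i j e' x y.
Qed.
End KoszulTensor.

Notation "f \otM g" := (gten f g) (at level 40, left associativity).

Section KoszulTensorComp.
Variable k : comPzRingType.
Implicit Types C D : gmod k.

Lemma gten_comp p q C C' C'' D D' D'' (f : gmap 0 C C') (f' : gmap 0 D D')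
    (g : gmap p C' C'') (g' : gmap q D' D'') n l
    (e1 : n + 0 = n) (e2 : n + (p + q) = l) (e : n + (0 + p + (0 + q)) = l) w :
  gten g g' e2 (gten f f' e1 w) = gten (g \oG f) (g' \oG f') e w.
Proof.
have tens_comp : gten g g' e2 \o gten f f' e1
    =1 gten (g \oG f) (g' \oG f') e.
  apply: tensor_ext => i j ei x y; subst n.
  rewrite -[LHS]/(gten g g' e2 (gten f f' e1 (tpure erefl x y))).
  rewrite (gtenE _ _ _ _ (addr0 i) (addr0 j) erefl).
  rewrite /ksign mul0r expr0 scale1r.
  have es : i + p + (j + q) = l by rewrite -e2 addrACA.
  rewrite (gtenE _ _ _ _ erefl erefl es).
  have ei : i + (0 + p) = i + p by rewrite add0r.
  have ej : j + (0 + q) = j + q by rewrite add0r.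
  rewrite (gtenE _ _ _ _ ei ej es) add0r.
  by rewrite (gcompE _ _ (addr0 i) erefl) (gcompE _ _ (addr0 j) erefl).
exact: tens_comp.
Qed.

Lemma gten_id C D : gid C \otM gid D = gid (C \otG D).
Proof.
apply: gtensor_map_ext => i j n m e e' x y; subst n.
have e'' : i + j = m by rewrite -e' addr0.
rewrite (gtenE _ _ _ _ (addr0 i) (addr0 j) e'') /ksign mul0r expr0 scale1r.
by move: e'; subst m => e'; rewrite !gidE.
Qed.
End KoszulTensorComp.

Section Kernel.
Variables (k : comPzRingType) (p : int) (C D : gmod k) (f : gmap p C D).

Section Component.
Variable n : int.

Definition ker_pred : {pred C n} := [pred x | f (erefl (n + p)) x == 0].

Lemma ker_submod : GRing.submod_closed ker_pred.
Proof.
split=> [|a x y]; rewrite !inE ?raddf0 // => /eqP fx /eqP fy.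
by rewrite linearP fx fy scaler0 addr0.
Qed.
HB.instance Definition _ := GRing.isSubmodClosed.Build k (C n) ker_pred ker_submod.

Record ker_part := KerPart { ker_val : C n; ker_valP : ker_val \in ker_pred }.
HB.instance Definition _ := [isSub for ker_val].
HB.instance Definition _ := [Choice of ker_part by <:].
HB.instance Definition _ := [SubChoice_isSubLmodule of ker_part by <:].

Lemma ker_val_linear : linear ker_val.
Proof. by move=> a x y; apply: (linearP (val : ker_part -> C n)). Qed.
End Component.

Definition gker : gmod k := fun n => ker_part n.

Definition gker_incl : gmap 0 gker C :=
  fun n m e => gid C e \o lin_pack (@ker_val_linear n).
End Kernel.

Definition im_eq (k : comPzRingType) (U V : lmodType k) (g : {linear U -> V})
    (x y : V) := exists a, x - y = g a.

Lemma im_refl (k : comPzRingType) (U V : lmodType k) (g : {linear U -> V}) x y :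
  x = y -> im_eq g x y.
Proof. by move=> ->; exists 0; rewrite subrr raddf0. Qed.

Definition im_premodule (k : comPzRingType) (U V : lmodType k)
    (g : {linear U -> V}) : premodule k.
Proof.
refine (@Premodule k V (im_eq g) 0 +%R -%R (fun a x => a *: x)
  _ _ _ _ _ _ _ _ _ _ _ _ _ _).
- by move=> x; apply: im_refl.
- by move=> x y [a xy]; exists (- a); rewrite -opprB xy linearN.
- move=> x y z [a xy] [b yz]; exists (a + b).
  by rewrite linearD -xy -yz addrA subrK.
- move=> x x' y y' [a xx'] [b yy']; exists (a + b).
  by rewrite opprD addrACA xx' yy' linearD.
- by move=> x x' [a xx']; exists (- a); rewrite -opprD xx' linearN.
- by move=> a x x' [b xx']; exists (a *: b); rewrite -scalerBr xx' linearZ.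
- by move=> x y z; apply: im_refl; rewrite addrA.
- by move=> x y; apply/im_refl/addrC.
- by move=> x; apply: im_refl; rewrite add0r.
- by move=> x; apply: im_refl; rewrite addNr.
- by move=> a b x; apply: im_refl; rewrite scalerA.
- by move=> x; apply: im_refl; rewrite scale1r.
- by move=> a x y; apply: im_refl; rewrite scalerDr.
- by move=> a b x; apply: im_refl; rewrite scalerDl.
Defined.

Section Cokernel.
Variables (k : comPzRingType) (p : int) (C D : gmod k) (f : gmap p C D).

Definition cok_premodule (n : int) := im_premodule (f (subrK p n)).

Definition gcok : gmod k := fun n => mquot (cok_premodule n).

Lemma gcok_pi_linear n : linear (@mclass k (cok_premodule n) : D n -> gcok n).
Proof. by move=> a x y; rewrite -mclassZ -mclassD. Qed.

Definition gcok_proj : gmap 0 D gcok :=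
  fun n m e => gid gcok e \o lin_pack (@gcok_pi_linear n).

Lemma gcok_projE n (e : n + 0 = n) x :
  gcok_proj e x = @mclass k (cok_premodule n) x.
Proof. by rewrite /gcok_proj /= gidE. Qed.

Lemma gcok_proj_comp : gcok_proj \oG f = (gzero : gmap (p + 0) C gcok).
Proof.
apply: gmap_ext => n m e x.
have e' : n + p = m by rewrite -e addr0.
rewrite (gcompE _ _ e' (addr0 m)) gcok_projE.
apply/(@mclassP k (cok_premodule m)); rewrite /= /im_eq subr0.
have en : n = m - p by rewrite -e' addrK.
by subst n; exists x; congr (f _ _); apply: eq_irrelevance.
Qed.

Section Lift.
Variables (q : int) (E : gmod k) (h : gmap q D E).
Hypothesis hf : forall n m l (e : n + p = m) (e' : m + q = l) x,
  h e' (f e x) = 0.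

Definition gcok_lift_fun n m (e : n + q = m) (x : gcok n) : E m :=
  h e (@mrep k (cok_premodule n) x).

Lemma gcok_lift_funE n m (e : n + q = m) x :
  gcok_lift_fun e (@mclass k (cok_premodule n) x) = h e x.
Proof.
have [a xy] := @mrep_eq k (cok_premodule n) x.
apply/eqP; rewrite -subr_eq0 /gcok_lift_fun -[_ - _](raddfB (h e)).
by apply/eqP; rewrite -(hf (subrK p n) e a); congr (h _ _).
Qed.

Lemma gcok_lift_linear n m (e : n + q = m) : linear (gcok_lift_fun e).
Proof.
move=> a; elim/mquotW=> x; elim/mquotW=> y.
by rewrite -mclassZ -mclassD !gcok_lift_funE; apply: (linearP (h e)).
Qed.

Definition gcok_lift : gmap q gcok E :=
  fun n m e => lin_pack (gcok_lift_linear e).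
End Lift.
End Cokernel.

(* Colimits are taken in graded modules and maps of degree 0. *)
Definition is_seq_colimit (k : comPzRingType) (X : nat -> gmod k)
    (t : forall s, gmap 0 (X s) (X s.+1))
    (L : gmod k) (i : forall s, gmap 0 (X s) L) : Prop :=
  (forall s, i s.+1 \oG t s = i s) /\
  (forall (M : gmod k) (f : forall s, gmap 0 (X s) M),
     (forall s, f s.+1 \oG t s = f s) ->
     exists! h : gmap 0 L M, forall s, h \oG i s = f s).

Record gcoalg (k : comPzRingType) := GCoalg {
  gc_mod :> gmod k;
  gc_comul : gmap 0 gc_mod (gc_mod \otG gc_mod);
  gc_counit : gmap 0 gc_mod (gunit k);
  gc_coassoc :
    associator gc_mod gc_mod gc_mod \oG (gc_comul \otM gid gc_mod) \oG gc_comul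
    = (gid gc_mod \otM gc_comul) \oG gc_comul;
  gc_counitl :
    lunitor gc_mod \oG (gc_counit \otM gid gc_mod) \oG gc_comul = gid gc_mod;
  gc_counitr :
    runitor gc_mod \oG (gid gc_mod \otM gc_counit) \oG gc_comul = gid gc_mod
}.
Arguments gc_comul {k} C [n m] : rename.
Arguments gc_counit {k} C [n m] : rename.

Definition is_coalg_map (k : comPzRingType) (C D : gcoalg k) (f : gmap 0 C D) :=
  gc_comul D \oG f = (f \otM f) \oG gc_comul C /\
  gc_counit D \oG f = gc_counit C.

(* k is a coalgebra by 1 |-> 1 (x) 1, with the identity as counit. *)
Section UnitCoalgebra.
Variable k : comPzRingType.

Definition unit_comul : gmap 0 (gunit k) (gunit k \otG gunit k) :=
  fun n m => match n return
      n + 0 = m -> {linear gunit k n -> (gunit k \otG gunit k) m} with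
  | Posz 0 => fun e =>
      lin_pack ((tpure_bilin (gunit k) (gunit k) e).1 (1 : k^o))
  | _ => fun _ => \0
  end.

Lemma gunit_ext p (C : gmod k) (f g : gmap p (gunit k) C) :
  (forall m (e : 0 + p = m), f 0 m e (1 : k) = g 0 m e (1 : k)) -> f = g.
Proof.
move=> fg; apply: gmap_ext => -[[|n]|n] m e x.
- rewrite -[x](@mulr1 k) -[X in f _ _ _ X]/((x : k) *: (1 : k^o)).
  rewrite -[X in g _ _ _ X]/((x : k) *: (1 : k^o)).
  by rewrite !linearZ; congr (_ *: _); apply: fg.
- by rewrite (thinmx0 x) !linear0.
- by rewrite (thinmx0 x) !linear0.
Qed.

Lemma unit_comul1 m (e : 0 + 0 = m) :
  @unit_comul 0 m e (1 : k) = @tpure k (gunit k) (gunit k) 0 0 m e (1 : k) (1 : k).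
Proof. by []. Qed.

Lemma unit_coassoc :
  associator (gunit k) (gunit k) (gunit k)
    \oG (unit_comul \otM gid (gunit k)) \oG unit_comul
  = (gid (gunit k) \otM unit_comul) \oG unit_comul.
Proof.
apply: gunit_ext => m e.
have e0 : 0 + 0 = m :> int by rewrite -e.
have e1 : m + 0 = m :> int by rewrite addr0.
have z : 0 + 0 = 0 :> int by [].
rewrite (gcompE _ _ e0 e1) [RHS](gcompE _ _ e0 e1).
rewrite unit_comul1 (gcompE _ _ e1 e1).
rewrite !(gtenE _ _ _ _ z z e0) /ksign mul0r expr0 !scale1r unit_comul1.
by rewrite (@associatorE _ _ _ _ _ _ _ _ _ _ z e0 z e0 _ _ e0) !gidE.
Qed.

Lemma unit_counitl :
  lunitor (gunit k) \oG (gid (gunit k) \otM gid (gunit k)) \oG unit_comul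
  = gid (gunit k).
Proof.
apply: gunit_ext => m e.
have e0 : 0 + 0 = m :> int by rewrite -e.
have e1 : m + 0 = m :> int by rewrite addr0.
have z : 0 + 0 = 0 :> int by [].
rewrite (gcompE _ _ e0 e1) unit_comul1 (gcompE _ _ e1 e1).
rewrite (gtenE _ _ _ _ z z e0) /ksign mul0r expr0 scale1r.
have e2 : 0 + 0 + 0 = m :> int by rewrite e0.
rewrite (tliftE _ _ _ e2) !gidE -[LHS]/(@gcast k (gunit k) 0 m _ ((1 : k) *: (1 : k^o))) scale1r.
by rewrite /gid; congr (gcast _ _ _); apply: eq_irrelevance.
Qed.

Lemma unit_counitr :
  runitor (gunit k) \oG (gid (gunit k) \otM gid (gunit k)) \oG unit_comul
  = gid (gunit k).
Proof.
apply: gunit_ext => m e.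
have e0 : 0 + 0 = m :> int by rewrite -e.
have e1 : m + 0 = m :> int by rewrite addr0.
have z : 0 + 0 = 0 :> int by [].
rewrite (gcompE _ _ e0 e1) unit_comul1 (gcompE _ _ e1 e1).
rewrite (gtenE _ _ _ _ z z e0) /ksign mul0r expr0 scale1r.
have e2 : 0 + 0 + 0 = m :> int by rewrite e0.
rewrite (tliftE _ _ _ e2) !gidE -[LHS]/(@gcast k (gunit k) 0 m _ ((1 : k) *: (1 : k^o))) scale1r.
by rewrite /gid; congr (gcast _ _ _); apply: eq_irrelevance.
Qed.

Definition unit_coalg : gcoalg k := GCoalg unit_coassoc unit_counitl unit_counitr.
End UnitCoalgebra.

Record aug_coalg (k : comPzRingType) := AugCoalg {
  ac_coalg :> gcoalg k;
  ac_aug : gmap 0 (unit_coalg k) ac_coalg;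
  ac_augP : is_coalg_map ac_aug
}.
Arguments ac_aug {k} C [n m] : rename.

Section Cocomplete.
Variables (k : comPzRingType) (C : aug_coalg k).

Definition reduced : gmod k := gcok (ac_aug C).
Definition reduced_proj : gmap 0 C reduced := gcok_proj (ac_aug C).

Lemma reduced_comul_aug (n m l : int) (e : n + 0 = m) (e' : m + 0 = l)
    (x : gunit k n) :
  ((reduced_proj \otM reduced_proj) \oG gc_comul C) e' (ac_aug C e x) = 0.
Proof.
rewrite (gcompE (reduced_proj \otM reduced_proj) (gc_comul C) (addr0 m) e').
rewrite -(gcompE (gc_comul C) (ac_aug C) e (addr0 m) e) (ac_augP C).1.
rewrite (gcompE _ (gc_comul (unit_coalg k)) e (addr0 m)).
rewrite (gten_comp (p := 0) (q := 0) _ _ _ _ _ _ e').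
set w := gc_comul _ _ _; move: w => w.
have -> : reduced_proj \oG ac_aug C = gzero by apply: gcok_proj_comp.
pose z := gzero : gmap 0 (unit_coalg k) reduced.
suff gz : gten z z e'
    =1 (\0 : {linear _ -> (reduced \otG reduced) l}) by exact: gz.
apply: tensor_ext => i j ei u v.
have es : i + j = l by rewrite ei -e' addr0.
rewrite (gtenE _ _ _ _ (addr0 i) (addr0 j) es) /z /gzero /=.
have [_ L] := tpure_bilin reduced reduced es.
by have := L 0 (-1) 0 0; rewrite scaler0 addr0 scaleN1r addNr => ->; rewrite scaler0.
Qed.

(* Determined by reduced_comul o pi = (pi (x) pi) o Delta, pi : C -> cok eps. *)
Definition reduced_comul : gmap 0 reduced (reduced \otG reduced) :=
  gcok_lift reduced_comul_aug.

(* [tpow s] has s + 1 tensor factors, and [comul_first s] applies the reduced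
   comultiplication to the first of them; thus [iter_comul s] is the iterated
   comultiplication Delta^(s+1), with Delta^(1) = id. *)
Fixpoint tpow (s : nat) : gmod k :=
  if s is s'.+1 then tpow s' \otG reduced else reduced.

Fixpoint comul_first (s : nat) : gmap 0 (tpow s) (tpow s.+1) :=
  match s return gmap 0 (tpow s) (tpow s.+1) with
  | 0%N => reduced_comul
  | s'.+1 => comul_first s' \otM gid reduced
  end.

Fixpoint iter_comul (s : nat) : gmap 0 reduced (tpow s) :=
  match s return gmap 0 reduced (tpow s) with
  | 0%N => gid reduced
  | s'.+1 => comul_first s' \oG iter_comul s'
  end.

(* ker Delta^(s+2) *)
Definition ker_iter (s : nat) : gmod k := gker (iter_comul s.+1).

Lemma ker_iter_sub s n (x : ker_iter s n) :
  ker_val x \in ker_pred (iter_comul s.+2) (n := n).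
Proof.
case: x => x /=; rewrite !inE => /eqP x0; apply/eqP.
have e2 : n + 0 + 0 = n + 0 by rewrite addr0.
by rewrite (gcompE (comul_first s.+1) (iter_comul s.+1) erefl e2) x0 linear0.
Qed.

Lemma ker_iter_trans_linear s n :
  linear (fun x : ker_iter s n => KerPart (ker_iter_sub x) : ker_iter s.+1 n).
Proof.
by move=> a x y; apply: val_inj; rewrite [RHS]ker_val_linear; apply: ker_val_linear.
Qed.

Definition ker_iter_trans s : gmap 0 (ker_iter s) (ker_iter s.+1) :=
  fun n m e => gid _ e \o lin_pack (@ker_iter_trans_linear s n).

Definition cocomplete : Prop :=
  is_seq_colimit ker_iter_trans (fun s => gker_incl (iter_comul s.+1)).
End Cocomplete.

(* The augmentation is not required to commute with the codifferential. *)
Record cga_coalg (k : comPzRingType) := CgaCoalg {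
  cc_aug_coalg :> aug_coalg k;
  cc_d : gmap 1 cc_aug_coalg cc_aug_coalg;
  cc_d2 : cc_d \oG cc_d = gzero;
  cc_coder : gc_comul cc_aug_coalg \oG cc_d
    = (cc_d \otM gid cc_aug_coalg \+G gid cc_aug_coalg \otM cc_d)
        \oG gc_comul cc_aug_coalg;
  cc_cocomplete : cocomplete cc_aug_coalg
}.
Arguments cc_d {k} C [n m] : rename.

Record cga_hom (k : comPzRingType) (C D : cga_coalg k) := CgaHom {
  ch_map :> gmap 0 C D;
  ch_coalg : is_coalg_map ch_map;
  ch_aug : ch_map \oG ac_aug C = ac_aug D;
  ch_d : ch_map \oG cc_d C = cc_d D \oG ch_map
}.

(* Not necessarily unital. As for [gmap], the degree of a product is a separate index. *)
Record cdg_alg (k : comPzRingType) := CdgAlg {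
  ca_mod :> gmod k;
  ca_mul : forall i j n : int, i + j = n -> ca_mod i -> ca_mod j -> ca_mod n;
  ca_curv : ca_mod 2;
  ca_d : gmap 1 ca_mod ca_mod;
  ca_mul_bilin : forall i j n (e : i + j = n), bilin (ca_mul e);
  ca_mulA : forall i j l ij jl n (e1 : i + j = ij) (e2 : ij + l = n)
      (e3 : j + l = jl) (e4 : i + jl = n) a b c,
    ca_mul e2 (ca_mul e1 a b) c = ca_mul e4 a (ca_mul e3 b c);
  ca_d_curv : forall n (e : 2 + 1 = n), ca_d e ca_curv = 0;
  ca_d2 : forall n m l (e1 : n + 1 = m) (e2 : m + 1 = l)
      (e3 : 2 + n = l) (e4 : n + 2 = l) a,
    ca_d e2 (ca_d e1 a) = ca_mul e3 ca_curv a - ca_mul e4 a ca_curv;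
  ca_leibniz : forall i j n i' j' n' (e : i + j = n) (en : n + 1 = n')
      (ei : i + 1 = i') (ej : j + 1 = j') (e1 : i' + j = n') (e2 : i + j' = n')
      a b,
    ca_d en (ca_mul e a b)
    = ca_mul e1 (ca_d ei a) b + ksign k i *: ca_mul e2 a (ca_d ej b)
}.
Arguments ca_mul {k} A [i j n] : rename.
Arguments ca_curv {k} A : rename.
Arguments ca_d {k} A [n m] : rename.

Record cdg_hom (k : comPzRingType) (A B : cdg_alg k) := CdgHom {
  ah_map :> gmap 0 A B;
  ah_curv : ah_map @0 (ca_curv A) = ca_curv B;
  ah_mul : forall i j n (e : i + j = n) a b,
    ah_map @0 (ca_mul A e a b) = ca_mul B e (ah_map @0 a) (ah_map @0 b);
  ah_d : ah_map \oG ca_d A = ca_d B \oG ah_map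
}.

Section StructureMaps.
Variables (k : comPzRingType) (A : cdg_alg k).

Lemma m0_linear m (e : 0 + 2 = m) :
  linear (fun a : k^o => (a : k) *: gcast A (etrans (esym (add0r 2)) e) (ca_curv A)).
Proof. by move=> a x y; rewrite scalerDl scalerA. Qed.

Definition m0 : gmap 2 (gunit k) A :=
  fun n m => match n return n + 2 = m -> {linear gunit k n -> A m} with
  | Posz 0 => fun e => lin_pack (m0_linear e)
  | _ => fun _ => \0
  end.

Definition m1 : gmap 1 A A := ca_d A.

Lemma m2_bilin i j m (e : i + j + 0 = m) :
  bilin (ca_mul A (etrans (esym (addr0 (i + j))) e)).
Proof. exact: ca_mul_bilin. Qed.

Definition m2 : gmap 0 (A \otG A) A := tlift m2_bilin.
End StructureMaps.

Definition maurer_cartan (k : comPzRingType) (C : cga_coalg k) (A : cdg_alg k)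
    (tau : gmap 1 C A) : gmap 2 C A :=
  m0 A \oG gc_counit C
  \+G (m1 A \oG tau \+G tau \oG cc_d C)
  \+G m2 A \oG (tau \otM tau) \oG gc_comul C.

Record Tw (k : comPzRingType) (C : cga_coalg k) (A : cdg_alg k) := TwCochain {
  tw_map :> gmap 1 C A;
  tw_aug : tw_map \oG ac_aug C = gzero;
  tw_mc : maurer_cartan tw_map = gzero
}.

Record category := Category {
  ob :> Type;
  hom : ob -> ob -> Type;
  idm : forall X, hom X X;
  comp : forall X Y Z, hom Y Z -> hom X Y -> hom X Z;
  comp_idl : forall X Y (f : hom X Y), comp (idm Y) f = f;
  comp_idr : forall X Y (f : hom X Y), comp f (idm X) = f;
  compA : forall X Y Z W (h : hom Z W) (g : hom Y Z) (f : hom X Y),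
    comp h (comp g f) = comp (comp h g) f
}.
Arguments hom {c} X Y.
Arguments idm {c} X.
Arguments comp {c X Y Z} g f.

(* The extensions of a given map on objects to a functor. *)
Record functor_on (K L : category) (F : K -> L) := FunctorOn {
  fmap : forall X Y, hom X Y -> hom (F X) (F Y);
  fmap_id : forall X, fmap (idm X) = idm (F X);
  fmap_comp : forall X Y Z (g : hom Y Z) (f : hom X Y),
    fmap (comp g f) = comp (fmap g) (fmap f)
}.
Arguments fmap {K L F} _ [X Y] f.

Record functor (K L : category) := Functor {
  fobj :> K -> L;
  fmor :> functor_on fobj
}.

Definition sets : category :=
  @Category Type (fun X Y => X -> Y) (fun X x => x)
    (fun X Y Z g f x => g (f x))
    (fun X Y f => erefl) (fun X Y f => erefl) (fun X Y Z W h g f => erefl).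

Definition op (K : category) : category :=
  @Category K (fun X Y => hom Y X) (fun X => idm X)
    (fun X Y Z g f => comp f g)
    (fun X Y f => comp_idr f) (fun X Y f => comp_idl f)
    (fun X Y Z W h g f => esym (compA f g h)).

Section HomFunctors.
Variable K : category.

Definition hom_from (X : K) : functor K sets.
Proof.
refine (@Functor K sets (fun Y => hom X Y) (@FunctorOn K sets _
  (fun Y Z (g : hom Y Z) (f : hom X Y) => comp g f) _ _)).
- by move=> Y; apply/funext => f; apply: comp_idl.
- by move=> Y Z W g f; apply/funext => h; rewrite /= compA.
Defined.

Definition hom_to (Y : K) : functor (op K) sets.
Proof.
refine (@Functor (op K) sets (fun X : K => hom X Y) (@FunctorOn (op K) sets _
  (fun (X X' : K) (f : hom X' X) (g : hom X Y) => comp g f) _ _)).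
- by move=> X; apply/funext => f; apply: comp_idr.
- by move=> X Z W g f; apply/funext => h; rewrite /= compA.
Defined.
End HomFunctors.

Definition op_functor (K L : category) (F : functor K L) :
  functor (op K) (op L).
Proof.
refine (@Functor (op K) (op L) F (@FunctorOn (op K) (op L) F
  (fun X Y f => fmap F f) _ _)).
- exact: (fmap_id F).
- by move=> X Y Z g f; apply: (fmap_comp F).
Defined.

Definition comp_functor (K L M : category) (G : functor L M) (F : functor K L) :
  functor K M.
Proof.
refine (@Functor K M (fun X => G (F X)) (@FunctorOn K M _
  (fun X Y f => fmap G (fmap F f)) _ _)).
- by move=> X; rewrite !fmap_id.
- by move=> X Y Z g f; rewrite !fmap_comp.
Defined.

Definition natural (K L : category) (F G : functor K L)
    (phi : forall X, hom (F X) (G X)) : Prop :=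
  forall X Y (f : hom X Y),
    comp (phi Y) (fmap F f) = comp (fmap G f) (phi X).

Definition is_iso (K : category) (X Y : K) (f : hom X Y) : Prop :=
  exists g : hom Y X, comp g f = idm X /\ comp f g = idm Y.

Record nat_iso (K L : category) (F G : functor K L) := NatIso {
  nt_map :> forall X, hom (F X) (G X);
  nt_natural : natural nt_map;
  nt_iso : forall X, is_iso (nt_map X)
}.

Definition corepresentable (K : category) (F : functor K sets) : Prop :=
  exists X : K, inhabited (nat_iso F (hom_from X)).

Section Instances.
Variable k : comPzRingType.

Lemma ch_ext (C D : cga_coalg k) (f g : cga_hom C D) :
  ch_map f = ch_map g -> f = g.
Proof.
case: f g => [f f1 f2 f3] [g g1 g2 g3] /= fg; subst g.
by congr CgaHom; apply: Prop_irrelevance.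
Qed.

Lemma ah_ext (A B : cdg_alg k) (f g : cdg_hom A B) :
  ah_map f = ah_map g -> f = g.
Proof.
case: f g => [f f1 f2 f3] [g g1 g2 g3] /= fg; subst g.
by congr CdgHom; apply: Prop_irrelevance.
Qed.

Lemma tw_ext (C : cga_coalg k) (A : cdg_alg k) (s t : Tw C A) :
  tw_map s = tw_map t -> s = t.
Proof.
case: s t => [s s1 s2] [t t1 t2] /= st; subst t.
by congr TwCochain; apply: Prop_irrelevance.
Qed.

Definition cga_idm (C : cga_coalg k) : cga_hom C C.
Proof.
refine (@CgaHom k C C (gid C) (conj _ _) _ _).
- rewrite gten_id; apply: gmap_ext => n m e x.
  by rewrite (gcomp_id _ _ e) (gid_comp _ _ e).
- by apply: gmap_ext => n m e x; rewrite (gcomp_id _ _ e).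
- by apply: gmap_ext => n m e x; rewrite (gid_comp _ _ e).
- by apply: gmap_ext => n m e x; rewrite (gcomp_id _ _ e) (gid_comp _ _ e).
Defined.

Definition cga_comp (B C D : cga_coalg k) (g : cga_hom C D) (f : cga_hom B C) :
  cga_hom B D.
Proof.
refine (@CgaHom k B D (g \oG f) (conj _ _) _ _).
- apply: gmap_ext => n m e x.
  rewrite (gcompA 0 0 0 _ _ _ _ e) (ch_coalg g).1 -(gcompA 0 0 0 _ _ _ e).
  rewrite [LHS](gcomp0E (ch_map g \otM ch_map g) _ _ e) (ch_coalg f).1.
  rewrite (gcomp0E (ch_map f \otM ch_map f) _ _ (addr0 n)).
  rewrite [RHS](gcomp0E (gten _ _) _ _ e).
  exact: (gten_comp (p := 0) (q := 0)).
- apply: gmap_ext => n m e x.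
  by rewrite (gcompA 0 0 0 _ _ _ _ e) (ch_coalg g).2 (ch_coalg f).2.
- apply: gmap_ext => n m e x.
  by rewrite -(gcompA 0 0 0 _ _ _ e) (ch_aug f) (ch_aug g).
- apply: gmap_ext => n m e x.
  rewrite -(gcompA 1 0 0 _ _ _ e) (ch_d f) (gcompA 0 1 0 _ _ _ _ e) (ch_d g).
  by rewrite -(gcompA 0 0 1 _ _ _ e).
Defined.

Definition CgaCdg : category.
Proof.
refine (@Category (cga_coalg k) (@cga_hom k) cga_idm cga_comp _ _ _).
- by move=> C D f; apply/ch_ext/gmap_ext => n m e x; apply: gid_comp.
- by move=> C D f; apply/ch_ext/gmap_ext => n m e x; apply: gcomp_id.
- by move=> B C D E h g f; apply/ch_ext/gmap_ext => n m e x; apply: gcompA.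
Defined.
End Instances.

Section TwistingFunctors.
Variable k : comPzRingType.

Definition cdg_idm (A : cdg_alg k) : cdg_hom A A.
Proof.
refine (@CdgHom k A A (gid A) _ _ _).
- exact: gidE.
- by move=> i j n e a b; rewrite /gapp0 !gidE.
- by apply: gmap_ext => n m e x; rewrite (gcomp_id _ _ e) (gid_comp _ _ e).
Defined.

Lemma gapp0_comp (C D E : gmod k) (g : gmap 0 D E) (f : gmap 0 C D) n (x : C n) :
  gapp0 (g \oG f : gmap 0 C E) n x = g @0 (f @0 x).
Proof. exact: gcompE. Qed.

Definition cdg_comp (A B C : cdg_alg k) (g : cdg_hom B C) (f : cdg_hom A B) :
  cdg_hom A C.
Proof.
refine (@CdgHom k A C (g \oG f) _ _ _).
- by rewrite gapp0_comp !ah_curv.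
- by move=> i j n e a b; rewrite !gapp0_comp !ah_mul.
- apply: gmap_ext => n m e x.
  rewrite -(gcompA 1 0 0 _ _ _ e) (ah_d f) (gcompA 0 1 0 _ _ _ _ e) (ah_d g).
  by rewrite -(gcompA 0 0 1 _ _ _ e).
Defined.

Definition Alg02 : category.
Proof.
refine (@Category (cdg_alg k) (@cdg_hom k) cdg_idm cdg_comp _ _ _).
- by move=> A B f; apply/ah_ext/gmap_ext => n m e x; apply: gid_comp.
- by move=> A B f; apply/ah_ext/gmap_ext => n m e x; apply: gcomp_id.
- by move=> A B C D h g f; apply/ah_ext/gmap_ext => n m e x; apply: gcompA.
Defined.

Lemma maurer_cartanE (C : cga_coalg k) (A : cdg_alg k) (tau : gmap 1 C A)
    n m l (e1 : n + 1 = m) (e2 : m + 1 = l) (e : n + 2 = l) x :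
  maurer_cartan tau e x
  = m0 A e (gc_counit C (addr0 n) x)
    + (m1 A e2 (tau _ _ e1 x) + tau _ _ e2 (cc_d C e1 x))
    + m2 A (addr0 l) (gten tau tau e (gc_comul C (addr0 n) x)).
Proof.
rewrite -[LHS]/((m0 A \oG gc_counit C) e x
  + ((m1 A \oG tau) e x + (tau \oG cc_d C) e x)
  + (m2 A \oG (tau \otM tau) \oG gc_comul C) e x).
congr (_ + (_ + _) + _); try exact: gcompE.
by rewrite (gcomp0E _ _ _ e); exact: gcompE.
Qed.

Lemma ah_m0 (A B : cdg_alg k) (f : cdg_hom A B) n m (e : n + 2 = m) x :
  f @0 (m0 A e x) = m0 B e x.
Proof.
have -> : m0 B = f \oG m0 A.
  apply: gunit_ext => {}m {}e; rewrite (gcompE (ah_map f) _ e (addr0 m)) /=.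
  by rewrite !scale1r -(ah_curv f) /gapp0; subst m; rewrite !gcast_id.
by symmetry; exact: gcompE.
Qed.

Lemma ah_m2 (C : gmod k) (A B : cdg_alg k) (f : cdg_hom A B) (tau : gmap 1 C A)
    n m (e : n + 2 = m) w :
  f @0 (m2 A (addr0 m) (gten tau tau e w))
  = m2 B (addr0 m) (gten (f \oG tau) (f \oG tau) e w).
Proof.
have h : gapp0 f m \o (m2 A (addr0 m) \o gten tau tau e)
    =1 m2 B (addr0 m) \o gten (f \oG tau) (f \oG tau) e.
  apply: tensor_ext => i j ei x y.
  rewrite -[LHS]/(gapp0 f m (m2 A (addr0 m)
    (gten tau tau e (tpure ei x y)))).
  rewrite -[RHS]/(m2 B (addr0 m) (gten (f \oG tau) (f \oG tau) e (tpure ei x y))).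
  have es : i + 1 + (j + 1) = m by rewrite addrACA ei.
  have es0 : i + 1 + (j + 1) + 0 = m by rewrite addr0.
  rewrite (gtenE _ _ _ _ erefl erefl es).
  rewrite (gtenE (p := 1) (q := 1) _ _ _ _ erefl erefl es).
  rewrite !linearZ; congr (_ *: _).
  rewrite !(tliftE _ _ _ es0).
  rewrite (gcompE (ah_map f) tau erefl (addr0 (i + 1))).
  rewrite (gcompE (ah_map f) tau erefl (addr0 (j + 1))).
  exact: (ah_mul f).
exact: h.
Qed.

Definition Tw_post (C : cga_coalg k) (A B : cdg_alg k) (f : cdg_hom A B)
    (tau : Tw C A) : Tw C B.
Proof.
refine (@TwCochain k C B (f \oG tau) _ _).
- apply: gmap_ext => n m e x.
  by rewrite -(gcompA 0 1 0 _ _ _ e) (tw_aug tau) (gcompE (ah_map f) _ e (addr0 m)) linear0.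
- apply: gmap_ext => n m e x.
  have e2 : n + 1 + 1 = m by rewrite -addrA.
  rewrite (maurer_cartanE _ erefl e2).
  rewrite -(ah_m0 f) -(ah_m2 f).
  rewrite (gcompE (ah_map f) (tw_map tau) erefl (addr0 _)).
  rewrite (gcompE (ah_map f) (tw_map tau) e2 (addr0 m)).
  rewrite -(gcompE (ca_d B) (ah_map f) (addr0 _) e2 e2) -(ah_d f).
  rewrite (gcompE (ah_map f) (ca_d A) e2 (addr0 m)) -!linearD.
  by rewrite -(maurer_cartanE _ erefl e2) (tw_mc tau) linear0.
Defined.

Definition Tw_pre (C D : cga_coalg k) (g : cga_hom C D) (A : cdg_alg k)
    (tau : Tw D A) : Tw C A.
Proof.
refine (@TwCochain k C A (tau \oG g) _ _).
- apply: gmap_ext => n m e x.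
  by rewrite -(gcompA 0 0 1 _ _ _ e) (ch_aug g) (tw_aug tau).
- apply: gmap_ext => n m e x.
  have e2 : n + 1 + 1 = m by rewrite -addrA.
  rewrite (maurer_cartanE _ erefl e2).
  rewrite !(gcompE (tw_map tau) (ch_map g) (addr0 _) _).
  rewrite -(gcompE (ch_map g) (cc_d C) erefl (addr0 _) erefl) (ch_d g).
  rewrite (gcompE (cc_d D) (ch_map g) (addr0 n) erefl).
  rewrite -(gten_comp (p := 1) (q := 1) _ _ _ _ (addr0 n) e).
  rewrite -(gcompE _ (gc_comul C) (addr0 n) (addr0 n) (addr0 n)).
  rewrite -(ch_coalg g).1 (gcompE (gc_comul D) _ (addr0 n) (addr0 n)).
  rewrite -(ch_coalg g).2 (gcompE (gc_counit D) _ (addr0 n) (addr0 n)).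
  by rewrite -(maurer_cartanE _ erefl e2) (tw_mc tau).
Defined.

Definition Tw_from (C : CgaCdg k) : functor Alg02 sets.
Proof.
refine (@Functor Alg02 sets (Tw C) (@FunctorOn Alg02 sets _
  (fun A B f => @Tw_post C A B f) _ _)).
- move=> A; apply/funext => tau; apply/tw_ext/gmap_ext => n m e x.
  exact: gid_comp.
- move=> A B D g f; apply/funext => tau; apply/tw_ext/gmap_ext => n m e x.
  by symmetry; exact: gcompA.
Defined.

Definition Tw_to (A : Alg02) : functor (op (CgaCdg k)) sets.
Proof.
refine (@Functor (op (CgaCdg k)) sets (fun C : CgaCdg k => Tw C A)
  (@FunctorOn (op (CgaCdg k)) sets _
  (fun (C D : CgaCdg k) (g : hom D C) => @Tw_pre D C g A) _ _)).
- move=> C; apply/funext => tau; apply/tw_ext/gmap_ext => n m e x.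
  exact: gcomp_id.
- move=> B C D g f; apply/funext => tau; apply/tw_ext/gmap_ext => n m e x.
  exact: gcompA.
Defined.
End TwistingFunctors.

(* Main.v *)
From mathcomp Require Import all_boot all_algebra.
From mathcomp Require Import boolp.
Require Import Defs.
Set Implicit Arguments.
Unset Strict Implicit.
Unset Printing Implicit Defensive.
Import GRing.Theory.
Local Open Scope ring_scope.

(** Curved dg algebras are the models of a many-sorted equational theory, and a
  twisting cochain on C is a family of elements, indexed by C, subject to
  equations in that theory. So a corepresenting object exists for the reason
  that presented algebras exist: [cobar] is generated by symbols of degree
  n + 1 for the x in C of degree n, modulo the equations that are forced.

  The equations are not listed. Two terms are identified when they have the
  same value under every twisting cochain tau : C -> A into every cdg algebra A.
  The quotient thus embeds in the product of all these A, hence it inherits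
  every identity valid in all of them: the axioms of a cdg algebra, the linearity
  of the generators in x, their vanishing on the augmentation, and the
  Maurer-Cartan equation. The last two are instances of [cobar_eq0], because
  evaluation at tau is a morphism that carries the tautological cochain
  [cobar_tw] to tau ([Tw_post_cobar]) and morphisms commute with the
  Maurer-Cartan expression ([maurer_cartan_post]). Terms being generated by the
  symbols, that morphism is the only one ([cobar_hom_uniq]).

  The second half is the Yoneda lemma, for any choice of corepresentatives:
  Omega D carries a universal cochain, f : C -> D pulls it back to a cochain
  from C to Omega D, and this is classified by a morphism from Omega C to
  Omega D. Functoriality and naturality in C both reduce to [phi_pre], which
  rests on the commutation of pullback along f with postcomposition. *)

(** * Morphisms and the Maurer-Cartan expression *)

(** The Maurer-Cartan expression of any degree 1 map, twisting or not, is built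
  from the operations that a morphism of cdg algebras preserves. *)
Lemma maurer_cartan_post (k : comPzRingType) (C : cga_coalg k)
    (A B : cdg_alg k) (f : cdg_hom A B) (tau : gmap 1 C A) n m (e : n + 2 = m) x :
  maurer_cartan (f \oG tau : gmap 1 C B) e x = f @0 (maurer_cartan tau e x).
Proof.
have e2 : n + 1 + 1 = m by rewrite -addrA.
rewrite !(maurer_cartanE _ erefl e2) !linearD ah_m0 -ah_m2.
congr (_ + (_ + _) + _); last exact: (gcompE (ah_map f) tau e2 (addr0 m)).
rewrite (gcompE (ah_map f) tau erefl (addr0 _)).
rewrite -(gcompE (ca_d B) (ah_map f) (addr0 _) e2 e2) -(ah_d f).
exact: (gcompE (ah_map f) (ca_d A) e2 (addr0 m)).
Qed.

(** * The cobar construction by generators *)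

Section CobarConstruction.
Variables (k : comPzRingType) (C : cga_coalg k).

(** Formal cdg expressions in the elements of C. The degree of a generator, a
  product or a differential is a separate index tied by a proof, as for [gmap]
  and [ca_mul], so that evaluation needs no transport. Opposites are multiples
  by -1. *)
Inductive cobar_term : int -> Type :=
| CGen n m : n + 1 = m -> C n -> cobar_term m
| CZero n : cobar_term n
| CAdd n : cobar_term n -> cobar_term n -> cobar_term n
| CScale n : k -> cobar_term n -> cobar_term n
| CMul i j n : i + j = n -> cobar_term i -> cobar_term j -> cobar_term n
| CCurv : cobar_term 2
| CDiff n m : n + 1 = m -> cobar_term n -> cobar_term m.

Fixpoint cobar_eval (A : cdg_alg k) (tau : gmap 1 C A) n (s : cobar_term n) :
    A n :=
  match s in cobar_term n return A n with
  | CGen _ _ e x => tau _ _ e x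
  | CZero _ => 0
  | CAdd _ s t => cobar_eval tau s + cobar_eval tau t
  | CScale _ a s => a *: cobar_eval tau s
  | CMul _ _ _ e s t => ca_mul A e (cobar_eval tau s) (cobar_eval tau t)
  | CCurv => ca_curv A
  | CDiff _ _ e s => ca_d A e (cobar_eval tau s)
  end.

(** The largest congruence under which every twisting cochain still induces a
  map; as it is defined through evaluations, each identity of cdg algebras
  holds modulo it by evaluating both sides. *)
Definition cobar_eq n (s t : cobar_term n) : Prop :=
  forall (A : cdg_alg k) (tau : Tw C A), cobar_eval tau s = cobar_eval tau t.

Definition cobar_premodule (n : int) : premodule k.
Proof.
refine (@Premodule k (cobar_term n) (@cobar_eq n) (CZero n) (@CAdd n)
  (CScale (-1)) (@CScale n) _ _ _ _ _ _ _ _ _ _ _ _ _ _).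
- by [].
- by move=> s t st A tau; rewrite st.
- by move=> s t u st tu A tau; rewrite st.
- by move=> s s' t t' ss' tt' A tau; rewrite /= ss' tt'.
- by move=> s s' ss' A tau; rewrite /= ss'.
- by move=> a s s' ss' A tau; rewrite /= ss'.
- by move=> s t u A tau; apply: addrA.
- by move=> s t A tau; apply: addrC.
- by move=> s A tau; apply: add0r.
- by move=> s A tau; rewrite /= scaleN1r addNr.
- by move=> a b s A tau; apply: scalerA.
- by move=> s A tau; apply: scale1r.
- by move=> a s t A tau; apply: scalerDr.
- by move=> a b s A tau; apply: scalerDl.
Defined.

Definition cobar_mod : gmod k := fun n => mquot (cobar_premodule n).

Definition cobar_class n (s : cobar_term n) : cobar_mod n :=
  @mclass k (cobar_premodule n) s.

Lemma cobar_classP n (s t : cobar_term n) :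
  cobar_class s = cobar_class t <-> cobar_eq s t.
Proof. exact: mclassP. Qed.

Lemma cobar_classW n (P : cobar_mod n -> Prop) :
  (forall s, P (cobar_class s)) -> forall q, P q.
Proof. exact: (@mquotW k (cobar_premodule n) P). Qed.

Lemma cobar_classD n (s t : cobar_term n) :
  cobar_class s + cobar_class t = cobar_class (CAdd s t).
Proof. exact/esym/(mclassD (P := cobar_premodule n)). Qed.

Lemma cobar_classZ n a (s : cobar_term n) :
  a *: cobar_class s = cobar_class (CScale a s).
Proof. exact/esym/(mclassZ (P := cobar_premodule n)). Qed.

Definition cobar_rep n (q : cobar_mod n) : cobar_term n :=
  @mrep k (cobar_premodule n) q.

Lemma cobar_rep_eq n (s : cobar_term n) : cobar_eq (cobar_rep (cobar_class s)) s.
Proof. exact: (@mrep_eq k (cobar_premodule n)). Qed.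

Definition cobar_mul i j n (e : i + j = n) (p : cobar_mod i) (q : cobar_mod j) :
    cobar_mod n :=
  cobar_class (CMul e (cobar_rep p) (cobar_rep q)).

Lemma cobar_mulE i j n (e : i + j = n) s t :
  cobar_mul e (cobar_class s) (cobar_class t) = cobar_class (CMul e s t).
Proof. by apply/cobar_classP => A tau /=; rewrite !cobar_rep_eq. Qed.

Definition cobar_d_fun n m (e : n + 1 = m) (q : cobar_mod n) : cobar_mod m :=
  cobar_class (CDiff e (cobar_rep q)).

Lemma cobar_d_funE n m (e : n + 1 = m) s :
  cobar_d_fun e (cobar_class s) = cobar_class (CDiff e s).
Proof. by apply/cobar_classP => A tau /=; rewrite cobar_rep_eq. Qed.

Lemma cobar_d_linear n m (e : n + 1 = m) : linear (cobar_d_fun e).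
Proof.
move=> a; elim/cobar_classW=> s; elim/cobar_classW=> t.
rewrite cobar_classZ cobar_classD !cobar_d_funE cobar_classZ cobar_classD.
by apply/cobar_classP => A tau; apply: linearP.
Qed.

Definition cobar_d : gmap 1 cobar_mod cobar_mod :=
  fun n m e => lin_pack (cobar_d_linear e).

Lemma cobar_dE n m (e : n + 1 = m) s :
  cobar_d e (cobar_class s) = cobar_class (CDiff e s).
Proof. exact: cobar_d_funE. Qed.

Definition cobar : cdg_alg k.
Proof.
refine (@CdgAlg k cobar_mod cobar_mul (cobar_class CCurv) cobar_d
  _ _ _ _ _).
- move=> i j n e; split.
  + elim/cobar_classW=> t a; elim/cobar_classW=> s; elim/cobar_classW=> s'.
    rewrite cobar_classZ cobar_classD !cobar_mulE cobar_classZ cobar_classD.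
    by apply/cobar_classP => A tau /=; have [L _] := ca_mul_bilin A e; apply: (L _ a).
  + elim/cobar_classW=> s a; elim/cobar_classW=> t; elim/cobar_classW=> t'.
    rewrite cobar_classZ cobar_classD !cobar_mulE cobar_classZ cobar_classD.
    by apply/cobar_classP => A tau /=; have [_ L] := ca_mul_bilin A e; apply: (L _ a).
- move=> i j l ij jl n e1 e2 e3 e4.
  elim/cobar_classW=> s; elim/cobar_classW=> t; elim/cobar_classW=> u.
  by rewrite !cobar_mulE; apply/cobar_classP => A tau /=; apply: ca_mulA.
- move=> n e; rewrite cobar_dE.
  by apply/(cobar_classP _ (CZero n)) => A tau /=; apply: ca_d_curv.
- move=> n m l e1 e2 e3 e4; elim/cobar_classW=> s.
  rewrite !cobar_dE !cobar_mulE -scaleN1r cobar_classZ cobar_classD.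
  by apply/cobar_classP => A tau /=; rewrite scaleN1r; apply: ca_d2.
- move=> i j n i' j' n' e en ei ej e1 e2.
  elim/cobar_classW=> s; elim/cobar_classW=> t.
  rewrite !(cobar_mulE, cobar_dE) cobar_classZ cobar_classD.
  by apply/cobar_classP => A tau /=; apply: ca_leibniz.
Defined.

Section Evaluation.
Variables (A : cdg_alg k) (tau : Tw C A).

Lemma cobar_eval_linear n :
  linear (fun q : cobar n => cobar_eval tau (cobar_rep q)).
Proof.
move=> a; elim/cobar_classW=> s; elim/cobar_classW=> t.
by rewrite cobar_classZ cobar_classD !cobar_rep_eq.
Qed.

Definition cobar_hom_map : gmap 0 cobar A :=
  fun n m e => gid A e \o lin_pack (@cobar_eval_linear n).

Lemma cobar_hom_mapE n (e : n + 0 = n) (s : cobar_term n) :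
  cobar_hom_map e (cobar_class s) = cobar_eval tau s.
Proof. by rewrite /cobar_hom_map /= gidE cobar_rep_eq. Qed.

Definition cobar_hom : cdg_hom cobar A.
Proof.
refine (@CdgHom k cobar A cobar_hom_map _ _ _).
- exact: cobar_hom_mapE.
- move=> i j n e; elim/cobar_classW=> s; elim/cobar_classW=> t.
  by rewrite [ca_mul _ _ _ _]cobar_mulE /gapp0 !cobar_hom_mapE.
- apply: gmap_ext => n m e; elim/cobar_classW=> s.
  have e' : n + 1 = m by rewrite -e.
  rewrite (gcompE _ (ca_d cobar) e' (addr0 m)) (gcompE _ _ (addr0 n) e').
  by rewrite [ca_d cobar _ _]cobar_dE !cobar_hom_mapE.
Defined.

End Evaluation.

(** Evaluations at twisting cochains are jointly injective. *)
Lemma cobar_eq0 n (q : cobar n) :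
  (forall (A : cdg_alg k) (tau : Tw C A), cobar_hom tau @0 q = 0) -> q = 0.
Proof.
elim/cobar_classW: q => s s0; apply/(cobar_classP _ (CZero n)) => A tau.
by rewrite -(cobar_hom_mapE _ (addr0 n)); apply: s0.
Qed.

Lemma cobar_gen_linear n m (e : n + 1 = m) :
  linear (fun x : C n => cobar_class (CGen e x) : cobar m).
Proof.
move=> a x y; rewrite cobar_classZ cobar_classD.
by apply/cobar_classP => A tau; apply: linearP.
Qed.

Definition cobar_gen : gmap 1 C cobar :=
  fun n m e => lin_pack (cobar_gen_linear e).

Lemma cobar_hom_gen (A : cdg_alg k) (tau : Tw C A) :
  cobar_hom tau \oG cobar_gen = tau :> gmap 1 C A.
Proof.
apply: gmap_ext => n m e x; rewrite (gcompE _ _ e (addr0 m)).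
exact: cobar_hom_mapE.
Qed.

(** The universal twisting cochain x |-> [x]. Both of its conditions hold in the
  target of each evaluation, where the cochain becomes a given twisting one. *)
Definition cobar_tw : Tw C cobar.
Proof.
refine (@TwCochain k C cobar cobar_gen _ _).
- apply: gmap_ext => n m e x; apply: cobar_eq0 => A tau.
  rewrite /gapp0 -(gcompE (ah_map (cobar_hom tau)) _ e (addr0 m) e).
  by rewrite (gcompA 0 1 0 _ _ _ _ e) cobar_hom_gen (tw_aug tau).
- apply: gmap_ext => n m e x; apply: cobar_eq0 => A tau.
  by rewrite -maurer_cartan_post cobar_hom_gen (tw_mc tau).
Defined.

Lemma Tw_post_cobar (A : cdg_alg k) (tau : Tw C A) :
  Tw_post (cobar_hom tau) cobar_tw = tau.
Proof. exact/tw_ext/cobar_hom_gen. Qed.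

(** The values of a morphism on all terms are forced by those on generators, by
  induction on the term. *)
Lemma cobar_hom_uniq (A : cdg_alg k) (tau : Tw C A) (g : cdg_hom cobar A) :
  Tw_post g cobar_tw = tau -> g = cobar_hom tau.
Proof.
move=> gtau; have gE n (s : cobar_term n) :
    g @0 (cobar_class s : cobar n) = cobar_eval tau s.
  elim: s => {n} [n m e x|n|n s IHs t IHt|n a s IHs|i j n e s IHs t IHt
    ||n m e s IHs] /=.
  - by rewrite -gtau; apply/esym/(gcompE (ah_map g) cobar_gen).
  - exact: linear0.
  - by rewrite -cobar_classD linearD IHs IHt.
  - by rewrite -cobar_classZ linearZ /= IHs.
  - by rewrite -cobar_mulE (ah_mul g e) IHs IHt.
  - exact: (ah_curv g).
  - have e1 : n + (1 + 0) = m by rewrite addr0.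
    rewrite -cobar_dE -IHs /gapp0.
    rewrite -(gcompE (ah_map g) (ca_d cobar) e (addr0 m) e1).
    by rewrite (ah_d g) (gcompE (ca_d A) _ (addr0 n) e).
apply/ah_ext/gmap_ext => n m e; have nm : n = m by rewrite -e addr0.
case: m / nm e => e; elim/cobar_classW=> s.
by rewrite [RHS]cobar_hom_mapE -gE /gapp0 (eq_irrelevance e (addr0 n)).
Qed.

Definition cobar_corep :
  nat_iso (Tw_from (C : CgaCdg k)) (hom_from (cobar : Alg02 k)).
Proof.
refine (@NatIso (Alg02 k) sets (Tw_from (C : CgaCdg k))
  (hom_from (cobar : Alg02 k)) (fun A tau => cobar_hom tau) _ _).
- move=> A B f; apply/funext => tau /=; apply/esym/cobar_hom_uniq.
  rewrite -[in RHS](Tw_post_cobar tau).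
  by rewrite [LHS](congr1 (@^~ cobar_tw)
    (fmap_comp (Tw_from (C : CgaCdg k)) f (cobar_hom tau))).
- move=> A; exists (fun g : cdg_hom cobar A => Tw_post g cobar_tw); split.
  + by apply/funext => tau; apply: Tw_post_cobar.
  + by apply/funext => g; apply/esym/cobar_hom_uniq.
Defined.

End CobarConstruction.

(** * Functoriality of corepresentatives *)

Section Functoriality.
Variable k : comPzRingType.

Lemma Tw_post_pre (C D : cga_coalg k) (A B : cdg_alg k) (g : cdg_hom A B)
    (f : cga_hom C D) (tau : Tw D A) :
  Tw_post g (Tw_pre f tau) = Tw_pre f (Tw_post g tau).
Proof. by apply/tw_ext/gmap_ext => n m e x; apply: (gcompA 0 1 0). Qed.

Variable Omega : CgaCdg k -> Alg02 k.
Variable phi : forall C : CgaCdg k, nat_iso (Tw_from C) (hom_from (Omega C)).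

Lemma ex_universal_tw (C : CgaCdg k) : exists tau : Tw C (Omega C),
  phi C (Omega C) tau = idm (Omega C).
Proof.
have [h [_ hK]] := nt_iso (phi C) (Omega C).
by exists (h (idm (Omega C))); apply: (congr1 (@^~ (idm (Omega C))) hK).
Qed.

Definition universal_tw (C : CgaCdg k) : Tw C (Omega C) :=
  sval (cid (ex_universal_tw C)).

Lemma phi_universal (C : CgaCdg k) :
  phi C (Omega C) (universal_tw C) = idm (Omega C).
Proof. exact: svalP (cid (ex_universal_tw C)). Qed.

Lemma phi_inj (C : CgaCdg k) (A : Alg02 k) : injective (phi C A).
Proof.
have [h [hK _]] := nt_iso (phi C) A.
by apply: (can_inj (g := h)) => tau; apply: (congr1 (@^~ tau) hK).
Qed.

Lemma phi_post (C : CgaCdg k) (A B : Alg02 k) (g : hom A B) (tau : Tw C A) :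
  phi C B (Tw_post g tau) = comp g (phi C A tau).
Proof. exact: (congr1 (@^~ tau) (nt_natural (phi C) g)). Qed.

Lemma phi_post_universal (C : CgaCdg k) (A : Alg02 k) (g : hom (Omega C) A) :
  phi C A (Tw_post g (universal_tw C)) = g.
Proof. by rewrite phi_post phi_universal comp_idr. Qed.

Lemma Tw_post_universal (C : CgaCdg k) (A : Alg02 k) (tau : Tw C A) :
  tau = Tw_post (phi C A tau) (universal_tw C).
Proof. by apply: phi_inj; rewrite phi_post_universal. Qed.

Definition corep_fmap (C D : CgaCdg k) (f : hom C D) :
    hom (Omega C) (Omega D) :=
  phi C (Omega D) (Tw_pre f (universal_tw D)).

(** Writing tau as a postcomposite of the universal cochain, the pullback along f
  passes under the postcomposition, which phi turns into a composition. *)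
Lemma phi_pre (C D : CgaCdg k) (f : hom C D) (A : Alg02 k) (tau : Tw D A) :
  phi C A (Tw_pre f tau) = comp (phi D A tau) (corep_fmap f).
Proof. by rewrite {1}[tau]Tw_post_universal -Tw_post_pre phi_post. Qed.

Definition corep_functor : functor_on Omega.
Proof.
refine (@FunctorOn (CgaCdg k) (Alg02 k) Omega corep_fmap _ _).
- move=> C; rewrite /corep_fmap.
  rewrite [Tw_pre _ _](congr1 (@^~ (universal_tw C)) (fmap_id (Tw_to (Omega C)) C)).
  exact: phi_universal.
- move=> B C D g f; rewrite {1}/corep_fmap.
  rewrite [Tw_pre _ _](congr1 (@^~ (universal_tw D))
    (@fmap_comp _ _ _ (Tw_to (Omega D)) D C B f g)).
  exact: phi_pre.
Defined.

End Functoriality.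

Theorem mainTheorem4 (k : comPzRingType) :
  (forall C : CgaCdg k, corepresentable (Tw_from C)) /\
  (forall (Omega : CgaCdg k -> Alg02 k)
          (phi : forall C : CgaCdg k, nat_iso (Tw_from C) (hom_from (Omega C))),
     exists F : functor_on Omega,
       forall A : Alg02 k,
         natural (F := Tw_to A)
                 (G := comp_functor (hom_to A) (op_functor (Functor F)))
                 (fun C => phi C A)).
Proof.
split=> [C|Omega phi]; first by exists (cobar C); constructor; apply: cobar_corep.
exists (corep_functor phi) => A D C f; apply/funext => tau.
exact: phi_pre.
Qed.
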